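(* Let $S$ be a proper sampling on $[n]$ with weights $\theta_C^i$ satisfying $\mathbb{E}[\theta_S\mathbf{I}_S]e=e$, and let each $f_i:\mathbb{R}^d\to\mathbb{R}$ be $L_i$-smooth (not necessarily convex). Let $\mathcal{L}_3$ be the constant defined in the context. (i) $$\mathcal{L}_3\le\frac{1}{n^2}\sum_{i,j=1}^n\ \sum_{C:\,i,j\in C}p_C\theta_C^i\theta_C^jL_iL_j.$$ Specifically, if $\theta_C^i=\frac{1}{p_i}$ for all $i$ and $C$, then $$\mathcal{L}_3\le\frac{1}{n^2}\sum_{i,j=1}^n\frac{\mathbf{P}_{ij}}{p_ip_j}L_iL_j.$$ (ii) $$\mathcal{L}_3\le\frac{1}{n^2}\sum_{i=1}^n\beta_iL_i^2.$$
   Context: $[n]=\{1,\dots,n\}$; $e\in\mathbb{R}^n$ is the all-ones vector. $L$-smooth means differentiable with $L$-Lipschitz gradient. A sampling is a random subset $S$ of $[n]$, with $p_C=\mathbb{P}[S=C]$ and $p_i=\mathbb{P}[i\in S]$; it is proper if $p_i>0$ for all $i$. $\mathbf{P}_{ij}=\mathbb{P}[i\in S\ \&\ j\in S]$. $\beta_i:=\sum_{C\subseteq[n]:\,i\in C}p_C|C|(\theta_C^i)^2$, where $|C|$ is the cardinality of $C$. $\theta_S\in\mathbb{R}^{n\times n}$ is a random diagonal matrix (determined by $S$) with diagonal entries $\theta_S^i$, $\mathbf{I}_S$ is the diagonal $0/1$ indicator matrix of $S$, and $\mathbf{G}(x)=[\nabla f_1(x),\dots,\nabla f_n(x)]$,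 so $\frac1n\mathbf{G}(x)\theta_S\mathbf{I}_Se=\frac1n\sum_{i\in S}\theta_S^i\nabla f_i(x)$. $\mathcal{L}_3$ is the smallest constant such that for all $x,y\in\mathbb{R}^d$: $\mathbb{E}\left[\|\frac1n(\mathbf{G}(x)-\mathbf{G}(y))\theta_S\mathbf{I}_Se-\frac1n(\mathbf{G}(x)-\mathbf{G}(y))e\|^2\right]\le\mathcal{L}_3\|x-y\|^2$.
   Formalization: The first bound of (i) is proved under the added assumption that the weights θ_C^i are nonnegative for i in C, since it fails for weights of mixed sign; the ''Specifically'' bound and (ii) need no such assumption. *)

(* Defs.v *)
From HB Require Import structures.
From mathcomp Require Import all_boot all_order all_algebra.
From mathcomp Require Import all_classical all_reals all_analysis.
Set Implicit Arguments.
Unset Strict Implicit.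
Unset Printing Implicit Defensive.
Import Order.TTheory GRing.Theory Num.Theory.
Import numFieldNormedType.Exports.
Local Open Scope classical_set_scope.
Local Open Scope ring_scope.

(* The norm that the library puts on matrices is the max norm, hence this
   separate definition; the derivative notions below do not depend on it. *)
Definition norm2 (R : realType) (d : nat) (v : 'cV[R]_d) : R :=
  Num.sqrt (\sum_(k < d) (v k ord0) ^+ 2).

Definition grad (R : realType) (d : nat) (f : 'cV[R]_d -> R) (x : 'cV[R]_d) :
    'cV[R]_d :=
  \col_(k < d) 'D_(delta_mx k ord0) f x.

Definition smooth (R : realType) (d : nat) (L : R) (f : 'cV[R]_d -> R) : Prop :=
  (forall x, differentiable f x) /\
  (forall x y, norm2 (grad f x - grad f y) <= L * norm2 (x - y)).

Section Sampling.
Context (disp : measure_display) (T : measurableType disp) (R : realType).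
Context (P : probability T R) (n : nat) (S : T -> {set 'I_n}).

(* {set 'I_n} is finite, so measurability is only needed for the fibres of S. *)
Definition is_sampling : Prop :=
  forall C : {set 'I_n}, measurable [set w | S w = C].

Definition prob_set (C : {set 'I_n}) : R := fine (P [set w | S w = C]).

Definition prob_elt (i : 'I_n) : R := fine (P [set w | i \in S w]).

Definition prob_pair (i j : 'I_n) : R :=
  fine (P [set w | i \in S w /\ j \in S w]).

Definition proper_sampling : Prop := forall i, 0 < prob_elt i.

Definition Emx (m p : nat) (X : T -> 'M[R]_(m, p)) : 'M[R]_(m, p) :=
  \matrix_(i, j) fine ('E_P[fun w => X w i j])%E.

End Sampling.

Section Weights.
Context (R : realType) (n : nat).

Definition ones : 'cV[R]_n := const_mx 1.

(* theta C i is the weight of i when the sampled set is C; its value is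
   irrelevant for i outside C, as it is always multiplied by ind_mx C. *)
Definition theta_mx (theta : {set 'I_n} -> 'I_n -> R) (C : {set 'I_n}) :
    'M[R]_n :=
  diag_mx (\row_i theta C i).

Definition ind_mx (C : {set 'I_n}) : 'M[R]_n :=
  diag_mx (\row_i (i \in C)%:R).

Definition grad_mx (d : nat) (f : 'I_n -> 'cV[R]_d -> R) (x : 'cV[R]_d) :
    'M[R]_(d, n) :=
  \matrix_(k, i) grad (f i) x k ord0.

End Weights.

Arguments ones {R n}.
Arguments ind_mx {R n} C.

Section Constants.
Context (disp : measure_display) (T : measurableType disp) (R : realType).
Context (P : probability T R) (n d : nat) (S : T -> {set 'I_n}).
Context (theta : {set 'I_n} -> 'I_n -> R) (f : 'I_n -> 'cV[R]_d -> R).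

Definition unbiased : Prop :=
  Emx P (fun w => theta_mx theta (S w) *m ind_mx (S w)) *m ones = ones.

Definition beta_coef (i : 'I_n) : R :=
  \sum_(C : {set 'I_n} | i \in C)
    prob_set P S C * #|C|%:R * (theta C i) ^+ 2.

Definition L3_constants : set R :=
  [set c : R | forall x y : 'cV[R]_d,
    ('E_P[fun w =>
        (norm2 (n%:R^-1 *: ((grad_mx f x - grad_mx f y)
                              *m theta_mx theta (S w) *m ind_mx (S w) *m ones)
                - n%:R^-1 *: ((grad_mx f x - grad_mx f y) *m ones)) ^+ 2)%R]
     <= (c * norm2 (x - y) ^+ 2)%:E)%E].

Definition is_L3 (c : R) : Prop :=
  L3_constants c /\ lbound L3_constants c.

End Constants.

(* Main.v *)
Require Import Defs.
From HB Require Import structures.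
From mathcomp Require Import all_boot all_order all_algebra.
From mathcomp Require Import all_classical all_reals all_analysis.
From mathcomp Require Import ring lra.
Import Order.TTheory GRing.Theory Num.Theory.
Import numFieldNormedType.Exports.
Local Open Scope classical_set_scope.
Local Open Scope ring_scope.

(** Unbiasedness of the weights says that the sampled gradient difference
    v_S = (1/n) sum_(i in S) theta_S^i g_i, with g_i = grad f_i x - grad f_i y,
    has expectation (1/n) sum_i g_i, which is the vector subtracted from it in
    the definition of the constant. The expectation in that definition is thus
    a variance, and it is at most the second moment of v_S
    ([variance_le_second_moment]). Every number c for which
    c |x - y|^2 dominates this second moment is therefore an admissible
    constant ([L3_constants_of_second_moment]), hence an upper bound of the
    least one.

    The second moment is a finite sum over the possible values C of S
    ([expectation_sampling]), and the two bounds come from two estimates of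
    |sum_(i in C) theta_C^i g_i|^2. Expanding it into inner products and using
    Cauchy-Schwarz with |g_i| <= L_i |x - y| gives the pairwise bound; this is
    where the weights must be nonnegative. Bounding it by
    |C| sum_(i in C) (theta_C^i)^2 |g_i|^2 ([norm2_sum_sqr_le]) gives the bound
    with the coefficients beta_i, whatever the signs of the weights. The case
    theta_C^i = 1/p_i is the pairwise bound, since the total probability of the
    sets that contain both i and j is P_ij ([prob_pairE]). *)

(** * Euclidean geometry of column vectors *)

(** The standard inner product on column vectors, whose norm is [norm2]. *)
Definition dotv {R : realType} {d : nat} (u v : 'cV[R]_d) : R :=
  \sum_(k < d) u k ord0 * v k ord0.

Lemma norm2_ge0 {R : realType} {d : nat} (v : 'cV[R]_d) : 0 <= norm2 v.
Proof. exact: sqrtr_ge0. Qed.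

Lemma norm2_sqr {R : realType} {d : nat} (v : 'cV[R]_d) :
  norm2 v ^+ 2 = \sum_(k < d) (v k ord0) ^+ 2.
Proof. by rewrite sqr_sqrtr// sumr_ge0// => k _; exact: sqr_ge0. Qed.

Lemma dotvv {R : realType} {d : nat} (v : 'cV[R]_d) : dotv v v = norm2 v ^+ 2.
Proof. by rewrite norm2_sqr; apply: eq_bigr => k _; rewrite expr2. Qed.

Lemma norm2Z {R : realType} {d : nat} (a : R) (v : 'cV[R]_d) :
  norm2 (a *: v) ^+ 2 = a ^+ 2 * norm2 v ^+ 2.
Proof.
by rewrite !norm2_sqr mulr_sumr; apply: eq_bigr => k _; rewrite mxE exprMn.
Qed.

Lemma norm2B_sqr {R : realType} {d : nat} (a b : R) (u v : 'cV[R]_d) :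
  norm2 (a *: u - b *: v) ^+ 2 =
  a ^+ 2 * norm2 u ^+ 2 + b ^+ 2 * norm2 v ^+ 2 - a * b * dotv u v *+ 2.
Proof.
rewrite !norm2_sqr !mulr_sumr -sumrMnl -big_split -sumrB /=.
by apply: eq_bigr => k _; rewrite !mxE; ring.
Qed.

Lemma dotv_le_norm2 {R : realType} {d : nat} (u v : 'cV[R]_d) :
  dotv u v <= norm2 u * norm2 v.
Proof.
have zero_le (w z : 'cV[R]_d) : norm2 w = 0 -> dotv w z <= norm2 w * norm2 z.
  move=> w0; rewrite w0 mul0r.
  (* A vector of norm zero has only zero coordinates. *)
  have /eqP := norm2_sqr w; rewrite w0 expr0n /= eq_sym psumr_eq0; last first.
    by move=> k _; exact: sqr_ge0.
  move=> /allP wk0; rewrite /dotv big1// => k _.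
  have := wk0 k (mem_index_enum k).
  by rewrite /= sqrf_eq0 => /eqP ->; rewrite mul0r.
have dotvC : dotv u v = dotv v u by apply: eq_bigr => k _; exact: mulrC.
have [/eqP u0|u0] := boolP (norm2 u == 0); first exact: zero_le.
have [/eqP v0|v0] := boolP (norm2 v == 0).
  by rewrite dotvC mulrC; exact: zero_le.
have uv0 : 0 < norm2 u * norm2 v by rewrite mulr_gt0// lt0r norm2_ge0 andbT.
(* The square of the norm of |v| u - |u| v is 2 |u| |v| (|u| |v| - u.v). *)
have := sqr_ge0 (norm2 (norm2 v *: u - norm2 u *: v)).
rewrite norm2B_sqr => h; rewrite -(ler_pM2l uv0); nra.
Qed.

(** Completing the square, from |u - v|^2 >= 0. *)
Lemma dotv_le_half {R : realType} {d : nat} (u v : 'cV[R]_d) :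
  dotv u v <= (norm2 u ^+ 2 + norm2 v ^+ 2) / 2.
Proof.
have := sqr_ge0 (norm2 (1 *: u - 1 *: v)); rewrite norm2B_sqr; lra.
Qed.

Lemma norm2_sum_sqr {R : realType} {d : nat} {I : finType} (A : {set I})
    (u : I -> 'cV[R]_d) :
  norm2 (\sum_(i in A) u i) ^+ 2 =
  \sum_(i in A) \sum_(j in A) dotv (u i) (u j).
Proof.
rewrite norm2_sqr; under eq_bigr do rewrite summxE expr2 big_distrlr /=.
by rewrite exchange_big; apply: eq_bigr => i _; rewrite exchange_big.
Qed.

(** The square of a sum of |A| vectors is at most |A| times the sum of the
    squares. *)
Lemma norm2_sum_sqr_le {R : realType} {d : nat} {I : finType} (A : {set I})
    (u : I -> 'cV[R]_d) :
  norm2 (\sum_(i in A) u i) ^+ 2 <= #|A|%:R * \sum_(i in A) norm2 (u i) ^+ 2.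
Proof.
rewrite norm2_sum_sqr.
apply: (@le_trans _ _ (\sum_(i in A) \sum_(j in A)
    (norm2 (u i) ^+ 2 + norm2 (u j) ^+ 2) / 2)).
  by apply: ler_sum => i _; apply: ler_sum => j _; exact: dotv_le_half.
under eq_bigr do rewrite -mulr_suml big_split /= sumr_const.
rewrite -mulr_suml big_split /= sumr_const sumrMnl -mulr_natl.
by set s := \sum_(i in A) _; lra.
Qed.

(** The second moment of a finitely supported random vector about its mean is
    at most its second moment about the origin. *)
Lemma variance_le_second_moment {R : realType} {d : nat} {I : finType}
    (p : I -> R) (v : I -> 'cV[R]_d) (m : 'cV[R]_d) :
  \sum_i p i = 1 -> \sum_i p i *: v i = m ->
  \sum_i p i * norm2 (v i - m) ^+ 2 <= \sum_i p i * norm2 (v i) ^+ 2.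
Proof.
move=> p1 vm.
have dotm : \sum_i p i * dotv (v i) m = norm2 m ^+ 2.
  rewrite -dotvv -{2}vm [RHS]/dotv; under eq_bigr do rewrite mulr_sumr.
  rewrite exchange_big; apply: eq_bigr => k _ /=.
  rewrite -vm summxE mulr_suml; apply: eq_bigr => i _.
  by rewrite !mxE mulrA.
under eq_bigr => i _.
  rewrite -[v i]scale1r -[m]scale1r norm2B_sqr expr1n !mul1r scale1r.
  rewrite mulrBr mulrDr mulrnAr; over.
rewrite sumrB big_split /= -mulr_suml p1 sumrMnl dotm mul1r.
by have := sqr_ge0 (norm2 m); lra.
Qed.

(** * Expectations of functions of a sampling *)

Section SamplingExpectation.
Context {disp : measure_display} {T : measurableType disp} {R : realType}.
Context (P : probability T R) {n : nat} {S : T -> {set 'I_n}}.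
Hypothesis samplingS : is_sampling S.

Lemma prob_set_ge0 (C : {set 'I_n}) : 0 <= prob_set P S C.
Proof. exact: fine_ge0. Qed.

(** No sign or integrability condition on [h] is needed: [h] composed with the
    sampling takes finitely many values. *)
Lemma expectation_sampling (h : {set 'I_n} -> R) :
  'E_P[fun w => h (S w)]%E = (\sum_C prob_set P S C * h C)%:E.
Proof.
pose A C := [set w | S w = C].
have -> : (fun w => h (S w)) = (fun w => \sum_C h C * \1_(A C) w).
  apply/funext => w; rewrite (bigD1 (S w))//= indicE mem_set// mulr1.
  rewrite big1 ?addr0// => C CS; rewrite indicE memNset ?mulr0//.
  by move=> /= SC; rewrite SC eqxx in CS.
rewrite unlock; under eq_integral do rewrite -sumEFin.
rewrite integral_sum//=; last first.
  move=> C.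
  have := integrableZl measurableT (h C) (integrable_indic P (samplingS C)).
  by apply: eq_integrable => // w _; rewrite EFinM.
rewrite -sumEFin; apply: eq_bigr => C _.
under eq_integral do rewrite EFinM.
rewrite (integralZl measurableT (integrable_indic P (samplingS C))).
rewrite integral_indic// classical_sets.setIT EFinM muleC.
by rewrite /prob_set fineK// fin_num_measure//; exact: samplingS.
Qed.

Lemma sum_prob_set : \sum_C prob_set P S C = 1.
Proof.
have := expectation_sampling (fun=> 1); rewrite -/(cst 1) expectation_cst.
by move=> [] ->; apply: eq_bigr => C _; rewrite mulr1.
Qed.

Lemma prob_pairE (i j : 'I_n) :
  prob_pair P S i j =
    \sum_(C : {set 'I_n} | (i \in C) && (j \in C)) prob_set P S C.
Proof.
pose h (C : {set 'I_n}) : R := ((i \in C) && (j \in C))%:R.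
pose A := [set w | i \in S w /\ j \in S w].
have AE : A = \bigcup_(C in [set C : {set 'I_n} | (i \in C) && (j \in C)])
    [set w | S w = C].
  apply/seteqP; split => w /=.
    by move=> [iS jS]; exists (S w) => //=; rewrite iS.
  by move=> [C /= /andP[iC jC] SC]; rewrite /A /= SC.
have mA : measurable A.
  by rewrite AE; apply: fin_bigcup_measurable => // C _; exact: samplingS.
have := expectation_sampling h.
have -> : (fun w => h (S w)) = \1_A.
  apply/funext => w; rewrite indicE /h; congr ((nat_of_bool _)%:R).
  by apply/idP/idP => [/andP[]|]; rewrite inE /A//= => -[-> ->].
rewrite expectation_indic// /prob_pair => -> /=.
rewrite [RHS]big_mkcond; apply: eq_bigr => C _.
by rewrite /h; case: ifP; rewrite ?mulr1 ?mulr0.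
Qed.

Lemma Emx_sampling {m q : nat} (M : {set 'I_n} -> 'M[R]_(m, q)) :
  Emx P (fun w => M (S w)) = \sum_C prob_set P S C *: M C.
Proof.
apply/matrixP => i j.
rewrite mxE (expectation_sampling (fun C => M C i j)) /= summxE.
by apply: eq_bigr => C _; rewrite mxE.
Qed.

End SamplingExpectation.

(** * The sampled gradient estimator *)

(** The matrix product in the definition of the constant, written as the
    weighted sum of the sampled columns. *)
Lemma grad_mx_sample {R : realType} {n d : nat}
    (theta : {set 'I_n} -> 'I_n -> R) (G : 'M[R]_(d, n)) (C : {set 'I_n}) :
  G *m theta_mx theta C *m ind_mx C *m ones =
  \sum_(i in C) theta C i *: col i G.
Proof.
apply/colP => k; rewrite mxE summxE [RHS]big_mkcond; apply: eq_bigr => i _.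
rewrite /theta_mx /ind_mx !mul_mx_diag !mxE mulr1.
by case: (i \in C); rewrite ?mulr1 ?mulr0// mulrC.
Qed.

Section EstimatorBounds.
Context {disp : measure_display} {T : measurableType disp} {R : realType}.
Context {P : probability T R} {n d : nat} {S : T -> {set 'I_n}}.
Context {theta : {set 'I_n} -> 'I_n -> R} {f : 'I_n -> 'cV[R]_d -> R}.
Context {L : 'I_n -> R}.
Hypothesis samplingS : is_sampling S.
Hypothesis unbiasedS : unbiased P S theta.

(** By unbiasedness the vector subtracted in the definition of the constant is
    the mean of the sampled one, so it suffices to bound the second moment of
    the weighted sum of the sampled gradient differences. *)
Lemma L3_constants_of_second_moment (c : R) :
  (forall x y, (n%:R ^+ 2)^-1 * (\sum_C prob_set P S C *
      norm2 (\sum_(i in C) theta C i *: (grad (f i) x - grad (f i) y)) ^+ 2)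
     <= c * norm2 (x - y) ^+ 2) ->
  L3_constants P S theta f c.
Proof.
move=> hc x y /=; set G := grad_mx f x - grad_mx f y.
pose v C := n%:R^-1 *: (G *m theta_mx theta C *m ind_mx C *m ones).
set m := n%:R^-1 *: (G *m ones).
rewrite (expectation_sampling P samplingS (fun C => norm2 (v C - m) ^+ 2)).
rewrite lee_fin; apply: le_trans (hc x y).
apply: le_trans (variance_le_second_moment (prob_set P S) v m
  (sum_prob_set P samplingS) _) _.
  (* The mean of the matrices theta_C I_C maps ones to ones. *)
  rewrite /m -[in RHS]unbiasedS.
  rewrite (Emx_sampling P samplingS (fun C => theta_mx theta C *m ind_mx C)).
  rewrite mulmx_suml mulmx_sumr scaler_sumr; apply: eq_bigr => C _.
  by rewrite /v -scalemxAl -scalemxAr !mulmxA scalerA mulrC -scalerA.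
rewrite mulr_sumr; apply: ler_sum => C _.
have colG i : col i G = grad (f i) x - grad (f i) y.
  by apply/colP => k; rewrite !mxE.
rewrite /v norm2Z grad_mx_sample exprVn mulrCA.
by under eq_bigr do rewrite colG.
Qed.

Hypothesis smoothf : forall i, smooth (L i) (f i).

(** No sign condition on [L i] is needed: L_i |x - y| bounds a norm, so it is
    nonnegative. *)
Lemma dotv_grad_le (i j : 'I_n) (x y : 'cV[R]_d) :
  dotv (grad (f i) x - grad (f i) y) (grad (f j) x - grad (f j) y)
    <= L i * L j * norm2 (x - y) ^+ 2.
Proof.
apply: le_trans (dotv_le_norm2 _ _) _.
rewrite expr2 mulrACA; apply: ler_pM; rewrite ?norm2_ge0//.
- exact: (smoothf i).2.
- exact: (smoothf j).2.
Qed.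

Lemma L3_constants_pairwise :
  (forall (C : {set 'I_n}) i, i \in C -> 0 <= theta C i) ->
  L3_constants P S theta f ((n%:R ^+ 2)^-1 *
    \sum_(i < n) \sum_(j < n) \sum_(C : {set 'I_n} | (i \in C) && (j \in C))
      prob_set P S C * theta C i * theta C j * L i * L j).
Proof.
move=> theta0; apply: L3_constants_of_second_moment => x y.
rewrite -mulrA ler_wpM2l ?invr_ge0 ?sqr_ge0//.
pose F (C : {set 'I_n}) i j :=
  prob_set P S C * theta C i * theta C j * L i * L j.
have -> : \sum_(i < n) \sum_(j < n)
      \sum_(C : {set 'I_n} | (i \in C) && (j \in C)) F C i j =
    \sum_(C : {set 'I_n}) \sum_(i in C) \sum_(j in C) F C i j.
  rewrite [RHS](exchange_big_dep xpredT)//=; apply: eq_bigr => i _.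
  by rewrite [RHS](exchange_big_dep xpredT).
rewrite mulr_suml; apply: ler_sum => C _.
rewrite norm2_sum_sqr mulr_sumr mulr_suml; apply: ler_sum => i iC.
rewrite mulr_sumr mulr_suml; apply: ler_sum => j jC.
set gi := _ - _; set gj := grad (f j) x - _.
have -> : dotv (theta C i *: gi) (theta C j *: gj) =
    theta C i * theta C j * dotv gi gj.
  by rewrite /dotv mulr_sumr; apply: eq_bigr => k _; rewrite !mxE mulrACA.
have -> : F C i j * norm2 (x - y) ^+ 2 = prob_set P S C *
    (theta C i * theta C j * (L i * L j * norm2 (x - y) ^+ 2)).
  by rewrite /F; ring.
rewrite ler_wpM2l ?prob_set_ge0// ler_wpM2l ?mulr_ge0 ?theta0//.
exact: dotv_grad_le.
Qed.

Lemma L3_constants_beta :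
  L3_constants P S theta f
    ((n%:R ^+ 2)^-1 * \sum_(i < n) beta_coef P S theta i * L i ^+ 2).
Proof.
apply: L3_constants_of_second_moment => x y.
rewrite -mulrA ler_wpM2l ?invr_ge0 ?sqr_ge0//.
under [X in _ <= X * _]eq_bigr do rewrite /beta_coef mulr_suml.
rewrite (exchange_big_dep xpredT)//= mulr_suml; apply: ler_sum => C _.
apply: le_trans (ler_wpM2l (prob_set_ge0 _ _) (norm2_sum_sqr_le _ _)) _.
rewrite mulrA mulr_sumr mulr_suml; apply: ler_sum => i iC.
have -> : prob_set P S C * #|C|%:R * theta C i ^+ 2 * L i ^+ 2 *
    norm2 (x - y) ^+ 2 = prob_set P S C * #|C|%:R *
    (theta C i ^+ 2 * (L i * L i * norm2 (x - y) ^+ 2)) by ring.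
rewrite ler_wpM2l ?mulr_ge0 ?prob_set_ge0// norm2Z ler_wpM2l ?sqr_ge0//.
by rewrite -dotvv; exact: dotv_grad_le.
Qed.

End EstimatorBounds.

Theorem lemmaH1 (R : realType) (disp : measure_display)
    (T : measurableType disp) (P : probability T R) (n d : nat)
    (S : T -> {set 'I_n}) (theta : {set 'I_n} -> 'I_n -> R)
    (f : 'I_n -> 'cV[R]_d -> R) (L : 'I_n -> R) (L3 : R)
    (samplingS : is_sampling S) (properS : proper_sampling P S)
    (unbiasedS : unbiased P S theta)
    (smoothf : forall i, smooth (L i) (f i))
    (L3P : is_L3 P S theta f L3) :
  (* (i): nonnegativity of the weights is used for the general bound only *)
  ((forall (C : {set 'I_n}) (i : 'I_n), i \in C -> 0 <= theta C i) ->
     L3 <= (n%:R ^+ 2)^-1 *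
       \sum_(i < n) \sum_(j < n)
         \sum_(C : {set 'I_n} | (i \in C) && (j \in C))
           prob_set P S C * theta C i * theta C j * L i * L j) /\
  ((forall (C : {set 'I_n}) (i : 'I_n), theta C i = (prob_elt P S i)^-1) ->
     L3 <= (n%:R ^+ 2)^-1 *
       \sum_(i < n) \sum_(j < n)
         prob_pair P S i j / (prob_elt P S i * prob_elt P S j) * L i * L j) /\
  (* (ii) *)
  L3 <= (n%:R ^+ 2)^-1 * \sum_(i < n) beta_coef P S theta i * L i ^+ 2.
Proof.
have pairwise := L3_constants_pairwise samplingS unbiasedS smoothf.
split=> [theta0|]; first exact: L3P.2 (pairwise theta0).
split=> [thetaE|]; last first.
  exact: L3P.2 (L3_constants_beta samplingS unbiasedS smoothf).
have theta0 (C : {set 'I_n}) i : i \in C -> 0 <= theta C i.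
  by rewrite thetaE invr_ge0 (ltW (properS i)).
have := L3P.2 _ (pairwise theta0); congr (is_true (_ <= _ * _)).
apply: eq_bigr => i _; apply: eq_bigr => j _.
rewrite prob_pairE// !mulr_suml; apply: eq_bigr => C _.
by rewrite !thetaE invfM; ring.
Qed.
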